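(* Let $N\ge1$, $h,l>0$ and $\theta\in\mathbb R^3$ with $\theta_1\theta_2\theta_3\neq0$. For the $N$-resonator system described in the context, let $T^{\mathrm{I,N}}$, $T^{\mathrm{I,D}}$, $T^{\mathrm{II,N}}$, $T^{\mathrm{II,D}}$ denote the transmission probabilities for type-I, respectively type-II, vertex conditions at all $v_j$, with Neumann (N), respectively Dirichlet (D), conditions at all $u_j$ (the same $N,h,l,\theta$ in all cases). Then the transmission probability is invariant under simultaneous interchange of vertex coupling type and endpoint boundary condition: for all $k>0$, $$T^{\mathrm{I,N}}(k)=T^{\mathrm{II,D}}(k),\qquad T^{\mathrm{I,D}}(k)=T^{\mathrm{II,N}}(k).$$
   Context: Model. The metric graph $G$ has vertices $v_1,\dots,v_N$ of degree 3, placed on the real line (the channel) at $x_j=(j-1)h$, and vertices $u_1,\dots,u_N$ of degree 1. The channel consists of the leads $e_{in}=(-\infty,0]$ (ending at $v_1$), $e_{out}=[(N-1)h,+\infty)$ (starting at $v_N$), and the segments of length $h$ between consecutive $v_j$'s. At each $v_j$ a resonator edge $(v_j,u_j)$ of length $l$ is attached, with coordinate $s\in[0,l]$, $s=0$ at $v_j$ and $s=l$ at $u_j$. At $v=v_j$, $\psi_1(v),\psi_2(v),\psi_3(v)$ denote the limits of $\psi$ at $v$ along the left channel edge, the right channel edge and the resonator edge, and $\psi_i'(v)$ the corresponding one-sided derivatives taken in the direction from $v$ into the edge. Vertex conditions at every $v_j$. Type I: $\frac{\psi_1(v)}{\theta_1}=\frac{\psi_2(v)}{\theta_2}=\frac{\psi_3(v)}{\theta_3}$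 and $\theta_1\psi_1'(v)+\theta_2\psi_2'(v)+\theta_3\psi_3'(v)=0$. Type II: $\frac{\psi_1'(v)}{\theta_1}=\frac{\psi_2'(v)}{\theta_2}=\frac{\psi_3'(v)}{\theta_3}$ and $\theta_1\psi_1(v)+\theta_2\psi_2(v)+\theta_3\psi_3(v)=0$. Endpoint condition at each $u_j$, at $s=l$: Neumann $\frac{d\psi}{ds}=0$; Dirichlet $\psi=0$. Scattering solution at wavenumber $k>0$: a function $\psi$ on $G$ with $\psi''+k^2\psi=0$ on every edge, satisfying all vertex and endpoint conditions, with $\psi(x)=e^{ikx}+r(k)e^{-ikx}$ on $e_{in}$ and $\psi(x)=t(k)e^{ikx}$ on $e_{out}$. The amplitudes are uniquely determined; the transmission probability is $T(k)=|t(k)|^2$. *)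

(* Defs.v *)
From Stdlib Require Import Reals ClassicalEpsilon.
From Coquelicot Require Import Coquelicot.

Open Scope R_scope.

Inductive coupling_type : Set := TypeI | TypeII.
Inductive endpoint_type : Set := Neumann | Dirichlet.

(* The edges of the graph with [N] resonators: [Channel 0] is the incoming lead,
   [Channel N] the outgoing lead, [Channel j] for [1 <= j < N] the segment from
   [v_j] to [v_(j+1)], and [Resonator j] for [1 <= j <= N] the edge [(v_j, u_j)]. *)
Inductive edge : Set :=
  | Channel (j : nat)
  | Resonator (j : nat).

Definition edge_of (N : nat) (e : edge) : Prop :=
  match e with
  | Channel j => (j <= N)%nat
  | Resonator j => (1 <= j <= N)%nat
  end.

Definition vertex_position (h : R) (j : nat) : R := (INR j - 1) * h.

(* Coordinate on a channel edge: the position on the real line.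
   Coordinate on a resonator: the distance [s] to [v_j]. *)
Definition edge_interior (N : nat) (h l : R) (e : edge) (x : R) : Prop :=
  match e with
  | Channel j =>
      ((0 < j)%nat -> vertex_position h j < x) /\
      ((j < N)%nat -> x < vertex_position h (S j))
  | Resonator _ => 0 < x < l
  end.

(* One function per edge: no continuity across a vertex is built in, and a
   function enters the vertex conditions only through its limits at the ends of
   the edges. *)
Definition graph_function : Type := edge -> R -> C.

Definition expi (x : R) : C := (cos x, sin x).

Definition helmholtz_on (I : R -> Prop) (k : R) (f : R -> C) : Prop :=
  exists f' : R -> C, forall x : R, I x ->
    is_derive (K := R_AbsRing) (V := C_R_NormedModule) f x (f' x) /\
    is_derive (K := R_AbsRing) (V := C_R_NormedModule) f' x
      (- (RtoC (k ^ 2) * f x))%C.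

(* [y] is the limit of [f] at [a] along [F], and [d] the derivative of [f] at [a]
   along [F] once [f] is given the value [y] at [a]; here [F] is [at_left a] or
   [at_right a]. *)
Definition one_sided_data (F : (R -> Prop) -> Prop) (f : R -> C) (a : R)
    (y d : C) : Prop :=
  filterlim f F (locally y) /\
  filterlim (fun x : R => ((f x - y) / RtoC (x - a))%C) F (locally d).

Definition left_data (f : R -> C) (a : R) : C -> C -> Prop :=
  one_sided_data (at_left a) f a.

Definition right_data (f : R -> C) (a : R) : C -> C -> Prop :=
  one_sided_data (at_right a) f a.

(* [y1 y2 y3] are the limits at the vertex and [d1 d2 d3] the derivatives
   in the direction from the vertex into the edge. *)
Definition coupling_condition (c : coupling_type) (theta1 theta2 theta3 : R)
    (y1 y2 y3 d1 d2 d3 : C) : Prop :=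
  match c with
  | TypeI =>
      (y1 / RtoC theta1 = y2 / RtoC theta2)%C /\
      (y2 / RtoC theta2 = y3 / RtoC theta3)%C /\
      (RtoC theta1 * d1 + RtoC theta2 * d2 + RtoC theta3 * d3 = RtoC 0)%C
  | TypeII =>
      (d1 / RtoC theta1 = d2 / RtoC theta2)%C /\
      (d2 / RtoC theta2 = d3 / RtoC theta3)%C /\
      (RtoC theta1 * y1 + RtoC theta2 * y2 + RtoC theta3 * y3 = RtoC 0)%C
  end.

(* On the left channel edge the direction into the edge is that of decreasing
   [x], hence the sign of [d1]. *)
Definition vertex_condition (h : R) (theta1 theta2 theta3 : R)
    (c : coupling_type) (psi : graph_function) (j : nat) : Prop :=
  exists y1 y2 y3 d1 d2 d3 : C,
    left_data (psi (Channel (pred j))) (vertex_position h j) y1 d1 /\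
    right_data (psi (Channel j)) (vertex_position h j) y2 d2 /\
    right_data (psi (Resonator j)) 0 y3 d3 /\
    coupling_condition c theta1 theta2 theta3 y1 y2 y3 (- d1)%C d2 d3.

Definition endpoint_condition (l : R) (b : endpoint_type)
    (psi : graph_function) (j : nat) : Prop :=
  exists y d : C,
    left_data (psi (Resonator j)) l y d /\
    match b with
    | Neumann => d = RtoC 0
    | Dirichlet => y = RtoC 0
    end.

Definition is_scattering_solution (N : nat) (h l theta1 theta2 theta3 : R)
    (c : coupling_type) (b : endpoint_type) (k : R)
    (psi : graph_function) (r t : C) : Prop :=
  (forall e : edge, edge_of N e ->
     helmholtz_on (edge_interior N h l e) k (psi e)) /\
  (forall j : nat, (1 <= j <= N)%nat ->
     vertex_condition h theta1 theta2 theta3 c psi j /\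
     endpoint_condition l b psi j) /\
  (forall x : R, x <= 0 ->
     psi (Channel 0) x = (expi (k * x) + r * expi (- (k * x)))%C) /\
  (forall x : R, vertex_position h N <= x ->
     psi (Channel N) x = (t * expi (k * x))%C).

(* For [N >= 1], [h, l, k > 0] and nonzero [theta]s a scattering solution exists
   and its amplitudes are unique, so [epsilon] picks the amplitude [t(k)]. *)
Definition transmission_amplitude (N : nat) (h l theta1 theta2 theta3 : R)
    (c : coupling_type) (b : endpoint_type) (k : R) : C :=
  epsilon (inhabits (RtoC 0)) (fun t : C =>
    exists (psi : graph_function) (r : C),
      is_scattering_solution N h l theta1 theta2 theta3 c b k psi r t).

Definition transmission_probability (N : nat) (h l theta1 theta2 theta3 : R)
    (c : coupling_type) (b : endpoint_type) (k : R) : R :=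
  Cmod (transmission_amplitude N h l theta1 theta2 theta3 c b k) ^ 2.

(* Main.v *)
Require Import Defs.
From Stdlib Require Import Reals Lra Lia Classical ClassicalEpsilon.
From Stdlib Require Import FunctionalExtensionality PropExtensionality.
From Coquelicot Require Import Coquelicot.

Open Scope R_scope.

(** The proof rests on a duality between scattering solutions.  If [psi] solves
    the problem, put [phi = (-1)^j psi' / (i k)] on [Channel j] and on
    [Resonator j].  Since [psi'' = - k^2 psi], one has
    [phi' = (-1)^j i k psi], so passing from [psi] to [phi] exchanges values and
    derivatives: Neumann ends become Dirichlet ends and conversely.  At a vertex
    the outward derivative on the left channel edge is [- d/dx]; the sign
    [(-1)^j], which flips from [Channel (j-1)] to [Channel j], makes up for
    this, so that the three outward derivatives of [psi] become values of [phi]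
    with one common factor, and the three values of [psi] become outward
    derivatives of [phi] with one common factor.  Hence type I becomes type II
    and conversely.  The incoming amplitude stays 1, the reflected amplitude
    changes sign, and [t] becomes [(-1)^N t], of the same modulus
    ([scattering_dual]).

    To work with limits at vertices, solutions are turned into linear algebra:
    on every edge [psi] is a combination of the two waves [e^(ikx)] and
    [e^(-ikx)] ([helmholtz_on_wave]), its one-sided data are those of that wave
    ([one_sided_data_wave]), and a scattering solution is a family of amplitudes
    subject to linear equations ([scattering_amplitude_system]).

    As the transmission amplitude is picked by [epsilon], the duality of
    solutions gives an equality of probabilities only if [t] is unique.  This
    follows from conservation of the flux [Im (conj psi * psi')], equal to
    [k (|A|^2 - |B|^2)] on a wave: nothing leaves through the resonators, and so
    a solution without incoming wave has [|r|^2 + |t|^2 = 0]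
    ([transmission_unique]). *)

(** * Waves on an edge *)

Lemma RtoC_neq_0 : forall x : R, x <> 0 -> RtoC x <> RtoC 0.
Proof. intros x Hx H. apply Hx. now injection H. Qed.

Definition wave (k : R) (A B : C) (x : R) : C :=
  (A * expi (k * x) + B * expi (- (k * x)))%C.

Definition wave_slope (k : R) (A B : C) (x : R) : C :=
  (RtoC k * Ci * (A * expi (k * x) - B * expi (- (k * x))))%C.

Lemma is_derive_C_components : forall (f : R -> C) (x : R) (d : C),
  is_derive (K := R_AbsRing) (V := C_R_NormedModule) f x d <->
  is_derive (fun t => fst (f t)) x (fst d) /\
  is_derive (fun t => snd (f t)) x (snd d).
Proof.
  intros f x d; split.
  - intros Hf; split.
    + apply (filterdiff_comp' (U := R_NormedModule)
        (V := prod_NormedModule R_AbsRing R_NormedModule R_NormedModule)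
        (W := R_NormedModule) f fst x (fun y => scal y d) fst Hf).
      apply filterdiff_linear, is_linear_fst.
    + apply (filterdiff_comp' (U := R_NormedModule)
        (V := prod_NormedModule R_AbsRing R_NormedModule R_NormedModule)
        (W := R_NormedModule) f snd x (fun y => scal y d) snd Hf).
      apply filterdiff_linear, is_linear_snd.
  - intros [H1 H2].
    pose proof (is_derive_plus (V := C_R_NormedModule) _ _ _ _ _
      (is_derive_scal_l (V := C_R_NormedModule) _ _ _ (1, 0) H1)
      (is_derive_scal_l (V := C_R_NormedModule) _ _ _ (0, 1) H2)) as H.
    replace d with (plus (G := C_R_NormedModule)
      (scal (V := C_R_NormedModule) (fst d) (1, 0))
      (scal (V := C_R_NormedModule) (snd d) (0, 1))).
    + apply (is_derive_ext (V := C_R_NormedModule)) with (2 := H).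
      intros t; unfold plus, scal; simpl; unfold prod_plus, prod_scal, plus, scal;
      simpl; unfold mult; simpl. destruct (f t); simpl; f_equal; ring.
    + unfold plus, scal; simpl; unfold prod_plus, prod_scal, plus, scal;
      simpl; unfold mult; simpl. destruct d; simpl; f_equal; ring.
Qed.

Lemma is_derive_wave : forall (k : R) (A B : C) (x : R),
  is_derive (K := R_AbsRing) (V := C_R_NormedModule) (wave k A B) x
    (wave_slope k A B x).
Proof.
  intros k A B x; apply is_derive_C_components; unfold wave, wave_slope, expi.
  split; simpl; auto_derive; trivial; ring.
Qed.

Lemma is_derive_wave_slope : forall (k : R) (A B : C) (x : R),
  is_derive (K := R_AbsRing) (V := C_R_NormedModule) (wave_slope k A B) x
    (- (RtoC (k ^ 2) * wave k A B x))%C.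
Proof.
  intros k A B x; apply is_derive_C_components; unfold wave, wave_slope, expi.
  split; simpl; auto_derive; trivial; ring.
Qed.

Lemma helmholtz_wave : forall (I : R -> Prop) (k : R) (A B : C) (f : R -> C),
  (forall x, f x = wave k A B x) -> helmholtz_on I k f.
Proof.
  intros I k A B f Hf. replace f with (wave k A B).
  - exists (wave_slope k A B); intros x _; split.
    + apply is_derive_wave.
    + apply is_derive_wave_slope.
  - apply functional_extensionality; intros x; now rewrite Hf.
Qed.

(** The set [I] is an interval, possibly empty or unbounded; the mean value
    theorem applies between any two of its points. *)
Lemma derive_zero_constant : forall (I : R -> Prop) (f : R -> R),
  (forall x y z, I x -> I z -> x <= y <= z -> I y) ->
  (forall x, I x -> is_derive f x 0) ->
  forall x y, I x -> I y -> f x = f y.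
Proof.
  intros I f HI Hf x y Hx Hy.
  assert (Hin : forall t, Rmin x y <= t <= Rmax x y -> I t).
  { intros t Ht. destruct (Rle_dec x y) as [Hxy | Hxy].
    - rewrite Rmin_left, Rmax_right in Ht by lra. exact (HI x t y Hx Hy Ht).
    - rewrite Rmin_right, Rmax_left in Ht by lra. exact (HI y t x Hy Hx Ht). }
  destruct (MVT_gen f x y (fun _ => 0)) as [c [_ Hc]].
  - intros t Ht; apply Hf, Hin; lra.
  - intros t Ht; apply derivable_continuous_pt; exists 0.
    apply is_derive_Reals, Hf, Hin, Ht.
  - lra.
Qed.

(** Variation of constants: the coefficients [g cos - (g'/k) sin] and
    [g sin + (g'/k) cos] have zero derivative. *)
Lemma real_helmholtz_sol : forall (I : R -> Prop) (k : R) (g g' : R -> R),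
  0 < k -> (forall x y z, I x -> I z -> x <= y <= z -> I y) ->
  (forall x, I x -> is_derive g x (g' x) /\ is_derive g' x (- (k ^ 2 * g x))) ->
  exists a b : R, forall x, I x -> g x = a * cos (k * x) + b * sin (k * x).
Proof.
  intros I k g g' Hk HI Hg.
  destruct (classic (exists x0, I x0)) as [[x0 H0] | Hempty].
  2: { exists 0, 0; intros x Hx; exfalso; apply Hempty; now exists x. }
  set (a := fun x => g x * cos (k * x) - g' x / k * sin (k * x)).
  set (b := fun x => g x * sin (k * x) + g' x / k * cos (k * x)).
  exists (a x0), (b x0); intros x Hx.
  replace (a x0) with (a x); [replace (b x0) with (b x)|].
  - unfold a, b. pose proof (sin2_cos2 (k * x)) as E; unfold Rsqr in E.
    transitivity (g x * (sin (k * x) * sin (k * x) + cos (k * x) * cos (k * x))).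
    + rewrite E; ring.
    + ring.
  - apply (derive_zero_constant I b HI); trivial.
    intros t Ht; destruct (Hg t Ht) as [G1 G2]; unfold b.
    auto_derive.
    + split; [now exists (g' t)|split; [now eexists; apply G2|trivial]].
    + apply is_derive_unique in G1; apply is_derive_unique in G2.
      change (Derive (fun u : R => g u) t = g' t) in G1.
      change (Derive (fun u : R => g' u) t = - (k ^ 2 * g t)) in G2.
      rewrite G1, G2; field; lra.
  - apply (derive_zero_constant I a HI); trivial.
    intros t Ht; destruct (Hg t Ht) as [G1 G2]; unfold a.
    auto_derive.
    + split; [now exists (g' t)|split; [now eexists; apply G2|trivial]].
    + apply is_derive_unique in G1; apply is_derive_unique in G2.
      change (Derive (fun u : R => g u) t = g' t) in G1.
      change (Derive (fun u : R => g' u) t = - (k ^ 2 * g t)) in G2.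
      rewrite G1, G2; field; lra.
Qed.

Lemma helmholtz_on_wave : forall (I : R -> Prop) (k : R) (f : R -> C),
  0 < k -> (forall x y z, I x -> I z -> x <= y <= z -> I y) ->
  helmholtz_on I k f ->
  exists A B : C, forall x, I x -> f x = wave k A B x.
Proof.
  intros I k f Hk HI [f' Hf].
  destruct (real_helmholtz_sol I k (fun x => fst (f x)) (fun x => fst (f' x)) Hk HI)
    as (a1 & b1 & H1).
  { intros x Hx; destruct (Hf x Hx) as [F1 F2]; split.
    - now apply is_derive_C_components in F1.
    - apply is_derive_C_components in F2; destruct F2 as [F2 _]; simpl in F2.
      replace (k ^ 2 * fst (f x)) with (k * (k * 1) * fst (f x) - 0 * snd (f x)) by ring.
      exact F2. }
  destruct (real_helmholtz_sol I k (fun x => snd (f x)) (fun x => snd (f' x)) Hk HI)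
    as (a2 & b2 & H2).
  { intros x Hx; destruct (Hf x Hx) as [F1 F2]; split.
    - now apply is_derive_C_components in F1.
    - apply is_derive_C_components in F2; destruct F2 as [_ F2]; simpl in F2.
      replace (k ^ 2 * snd (f x)) with (k * (k * 1) * snd (f x) + 0 * fst (f x)) by ring.
      exact F2. }
  (* With complex coefficients a and b, a cos + b sin has the amplitudes
     (a - i b) / 2 and (a + i b) / 2. *)
  exists ((a1 + b2) / 2, (a2 - b1) / 2), ((a1 - b2) / 2, (a2 + b1) / 2).
  intros x Hx. specialize (H1 x Hx); specialize (H2 x Hx); simpl in H1, H2.
  rewrite (surjective_pairing (f x)), H1, H2.
  unfold wave, expi; rewrite cos_neg, sin_neg.
  unfold Cplus, Cmult; simpl; f_equal; field.
Qed.

(** * One-sided data at the end of an edge *)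

Lemma filterlim_C_components : forall (F : (R -> Prop) -> Prop) (f : R -> C) (y : C),
  Filter F ->
  filterlim (fun x => fst (f x)) F (locally (fst y)) ->
  filterlim (fun x => snd (f x)) F (locally (snd y)) ->
  filterlim f F (locally y).
Proof.
  intros F f y HF H1 H2; apply filterlim_locally; intros eps.
  apply (filterlim_locally (U := R_UniformSpace)) with (eps := eps) in H1.
  apply (filterlim_locally (U := R_UniformSpace)) with (eps := eps) in H2.
  generalize (filter_and _ _ H1 H2); apply filter_imp; intros x [B1 B2].
  split; [exact B1 | exact B2].
Qed.

Lemma difference_quotient_lim : forall (F : (R -> Prop) -> Prop) (g : R -> R) (a d : R),
  Filter F -> filter_le F (locally a) -> F (fun x => x <> a) ->
  is_derive g a d ->
  filterlim (fun x => (g x - g a) / (x - a)) F (locally d).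
Proof.
  intros F g a d HF Hle Hne Hg.
  apply is_derive_Reals in Hg.
  apply (filterlim_locally (U := R_UniformSpace)); intros eps.
  destruct (Hg eps (cond_pos eps)) as [delta Hd].
  assert (Hball : F (ball a delta)) by (apply Hle; now exists delta).
  generalize (filter_and _ _ Hball Hne); apply filter_imp; intros x [Hx Hxa].
  specialize (Hd (x - a)). replace (a + (x - a)) with x in Hd by ring.
  apply Hd; [lra | exact Hx].
Qed.

Lemma one_sided_data_derive : forall (F : (R -> Prop) -> Prop) (f : R -> C) (a : R) (d : C),
  Filter F -> filter_le F (locally a) -> F (fun x => x <> a) ->
  is_derive (K := R_AbsRing) (V := C_R_NormedModule) f a d ->
  one_sided_data F f a (f a) d.
Proof.
  intros F f a d HF Hle Hne Hf.
  apply is_derive_C_components in Hf; destruct Hf as [H1 H2]; split.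
  - apply filterlim_C_components; trivial;
      apply (filterlim_filter_le_1 _ Hle).
    + apply (ex_derive_continuous (V := R_NormedModule)); now eexists; apply H1.
    + apply (ex_derive_continuous (V := R_NormedModule)); now eexists; apply H2.
  - apply filterlim_C_components; trivial.
    + apply filterlim_ext_loc with (2 := difference_quotient_lim F _ a _ HF Hle Hne H1).
      apply filter_imp with (2 := Hne); intros x Hx; simpl. field; lra.
    + apply filterlim_ext_loc with (2 := difference_quotient_lim F _ a _ HF Hle Hne H2).
      apply filter_imp with (2 := Hne); intros x Hx; simpl. field; lra.
Qed.

Lemma one_sided_data_unique : forall (F : (R -> Prop) -> Prop) (f : R -> C) (a : R) (y y' d d' : C),
  ProperFilter F -> one_sided_data F f a y d -> one_sided_data F f a y' d' ->
  y = y' /\ d = d'.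
Proof.
  intros F f a y y' d d' HF [H1 H2] [H1' H2'].
  assert (E : y = y').
  { exact (filterlim_locally_unique (FF := Proper_StrongProper F HF)
             (V := C_R_NormedModule) f y y' H1 H1'). }
  subst y'; split; trivial.
  exact (filterlim_locally_unique (FF := Proper_StrongProper F HF)
           (V := C_R_NormedModule) _ d d' H2 H2').
Qed.

Lemma one_sided_data_ext : forall (F : (R -> Prop) -> Prop) (f g : R -> C) (a : R) (y d : C),
  Filter F -> F (fun x => f x = g x) ->
  one_sided_data F f a y d -> one_sided_data F g a y d.
Proof.
  intros F f g a y d HF Hfg [H1 H2]; split.
  - exact (filterlim_ext_loc f g Hfg H1).
  - refine (filterlim_ext_loc _ _ _ H2).
    apply filter_imp with (2 := Hfg); intros x Hx; now rewrite Hx.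
Qed.

(** Limits along a proper filter are unique, so a function that is a wave near
    [a] on the relevant side has the data of that wave and no others. *)
Lemma one_sided_data_wave :
  forall (F : (R -> Prop) -> Prop) (f : R -> C) (k a : R) (A B : C),
  ProperFilter F -> filter_le F (locally a) -> F (fun x => x <> a) ->
  F (fun x => f x = wave k A B x) ->
  forall y d, one_sided_data F f a y d <-> y = wave k A B a /\ d = wave_slope k A B a.
Proof.
  intros F f k a A B HF Hle Hne Hf.
  assert (D : one_sided_data F f a (wave k A B a) (wave_slope k A B a)).
  { apply one_sided_data_ext with (wave k A B).
    - apply HF.
    - apply filter_imp with (2 := Hf); intros x Hx; now symmetry.
    - apply one_sided_data_derive; trivial; [apply HF | apply is_derive_wave]. }
  intros y d; split.
  - intros H; exact (one_sided_data_unique _ _ _ _ _ _ _ HF H D).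
  - intros [-> ->]; exact D.
Qed.

Lemma left_data_wave : forall (f : R -> C) (k a m : R) (A B : C),
  m < a -> (forall x, m < x < a -> f x = wave k A B x) ->
  forall y d, left_data f a y d <-> y = wave k A B a /\ d = wave_slope k A B a.
Proof.
  intros f k a m A B Hm Hf; apply one_sided_data_wave.
  - apply at_left_proper_filter.
  - apply filter_le_within.
  - exists (mkposreal 1 Rlt_0_1); intros x _ Hx; lra.
  - exists (mkposreal (a - m) ltac:(lra)); intros x Hx Hxa; apply Hf.
    apply Rabs_def2 in Hx; simpl in Hx; unfold minus, plus, opp in Hx; simpl in Hx; lra.
Qed.

Lemma right_data_wave : forall (f : R -> C) (k a m : R) (A B : C),
  a < m -> (forall x, a < x < m -> f x = wave k A B x) ->
  forall y d, right_data f a y d <-> y = wave k A B a /\ d = wave_slope k A B a.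
Proof.
  intros f k a m A B Hm Hf; apply one_sided_data_wave.
  - apply at_right_proper_filter.
  - apply filter_le_within.
  - exists (mkposreal 1 Rlt_0_1); intros x _ Hx; lra.
  - exists (mkposreal (m - a) ltac:(lra)); intros x Hx Hxa; apply Hf.
    apply Rabs_def2 in Hx; simpl in Hx; unfold minus, plus, opp in Hx; simpl in Hx; lra.
Qed.

(** * Scattering solutions as systems of amplitudes *)

Definition amplitude_condition (h l theta1 theta2 theta3 : R)
    (c : coupling_type) (b : endpoint_type) (k : R) (A B : edge -> C) (j : nat) : Prop :=
  let value e x := wave k (A e) (B e) x in
  let slope e x := wave_slope k (A e) (B e) x in
  let p := vertex_position h j in
  coupling_condition c theta1 theta2 theta3
    (value (Channel (pred j)) p) (value (Channel j) p) (value (Resonator j) 0)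
    (- slope (Channel (pred j)) p)%C (slope (Channel j) p) (slope (Resonator j) 0) /\
  match b with
  | Neumann => slope (Resonator j) l = RtoC 0
  | Dirichlet => value (Resonator j) l = RtoC 0
  end.

Definition amplitude_system (N : nat) (h l theta1 theta2 theta3 : R)
    (c : coupling_type) (b : endpoint_type) (k : R) (A B : edge -> C) : Prop :=
  forall j : nat, (1 <= j <= N)%nat ->
    amplitude_condition h l theta1 theta2 theta3 c b k A B j.

Lemma edge_interior_convex : forall N h l e x y z,
  edge_interior N h l e x -> edge_interior N h l e z -> x <= y <= z ->
  edge_interior N h l e y.
Proof.
  intros N h l [j | j] x y z; simpl; [|lra].
  intros [H1 _] [_ H2] Hy; split; intros Hj; [specialize (H1 Hj) | specialize (H2 Hj)]; lra.
Qed.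

Lemma vertex_position_S : forall h j, vertex_position h (S j) = vertex_position h j + h.
Proof. intros h j; unfold vertex_position; rewrite S_INR; ring. Qed.

Lemma vertex_data_waves : forall (N : nat) (h l k : R) (psi : graph_function) (A B : edge -> C),
  0 < h -> 0 < l ->
  (forall e, edge_of N e -> forall x, edge_interior N h l e x ->
     psi e x = wave k (A e) (B e) x) ->
  forall j, (1 <= j <= N)%nat -> forall theta1 theta2 theta3 c b,
    vertex_condition h theta1 theta2 theta3 c psi j /\ endpoint_condition l b psi j <->
    amplitude_condition h l theta1 theta2 theta3 c b k A B j.
Proof.
  intros N h l k psi A B Hh Hl Hpsi j Hj theta1 theta2 theta3 c b.
  unfold amplitude_condition.
  set (value := fun e x => wave k (A e) (B e) x).
  set (slope := fun e x => wave_slope k (A e) (B e) x).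
  set (p := vertex_position h j); cbv zeta.
  destruct j as [|i]; [lia|]; cbn [pred].
  assert (DL : forall y d, left_data (psi (Channel i)) p y d <->
    y = value (Channel i) p /\ d = slope (Channel i) p).
  { apply left_data_wave with (m := p - h); [lra|]; intros x Hx.
    apply Hpsi; simpl; [lia|]; split; intros Hi.
    - unfold p in Hx; rewrite vertex_position_S in Hx; lra.
    - apply Hx. }
  assert (DR : forall y d, right_data (psi (Channel (S i))) p y d <->
    y = value (Channel (S i)) p /\ d = slope (Channel (S i)) p).
  { apply right_data_wave with (m := p + h); [lra|]; intros x Hx.
    apply Hpsi; [simpl; lia|]; split; intros Hi.
    - apply Hx.
    - rewrite vertex_position_S; apply Hx. }
  assert (D0 : forall y d, right_data (psi (Resonator (S i))) 0 y d <->
    y = value (Resonator (S i)) 0 /\ d = slope (Resonator (S i)) 0).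
  { apply right_data_wave with (m := l); trivial; intros x Hx.
    apply Hpsi; [simpl; lia | exact Hx]. }
  assert (D1 : forall y d, left_data (psi (Resonator (S i))) l y d <->
    y = value (Resonator (S i)) l /\ d = slope (Resonator (S i)) l).
  { apply left_data_wave with (m := 0); trivial; intros x Hx.
    apply Hpsi; [simpl; lia | exact Hx]. }
  split.
  - intros [(y1 & y2 & y3 & d1 & d2 & d3 & H1 & H2 & H3 & Hc) (y & d & H4 & Hb)].
    apply DL in H1; apply DR in H2; apply D0 in H3; apply D1 in H4.
    destruct H1 as [-> ->], H2 as [-> ->], H3 as [-> ->], H4 as [-> ->].
    now split.
  - intros [Hc Hb]; split.
    + do 6 eexists; split; [|split; [|split; [|exact Hc]]].
      * apply DL; split; reflexivity.
      * apply DR; split; reflexivity.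
      * apply D0; split; reflexivity.
    + do 2 eexists; split; [apply D1; split; reflexivity | exact Hb].
Qed.

(** On the leads the prescribed form of [psi] already names the amplitudes: 1 and
    [r] on the incoming lead, [t] and 0 on the outgoing one.  The amplitude [r]
    is unconstrained, so it does not appear in the system. *)
Lemma scattering_amplitude_system :
  forall (N : nat) (h l theta1 theta2 theta3 : R) c b (k : R) (t : C),
  (1 <= N)%nat -> 0 < h -> 0 < l -> 0 < k ->
  (exists psi r, is_scattering_solution N h l theta1 theta2 theta3 c b k psi r t) <->
  (exists A B, amplitude_system N h l theta1 theta2 theta3 c b k A B /\
     A (Channel 0) = RtoC 1 /\ A (Channel N) = t /\ B (Channel N) = RtoC 0).
Proof.
  intros N h l theta1 theta2 theta3 c b k t HN Hh Hl Hk; split.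
  - intros (psi & r & Hode & Hv & Hin & Hout).
    assert (Hex : forall e, exists AB : C * C,
      (edge_of N e -> forall x, edge_interior N h l e x ->
         psi e x = wave k (fst AB) (snd AB) x) /\
      (e = Channel 0 -> fst AB = RtoC 1) /\
      (e = Channel N -> fst AB = t /\ snd AB = RtoC 0)).
    { intros e.
      destruct (classic (e = Channel 0)) as [-> | H0].
      { exists (RtoC 1, r); cbn [fst snd]; repeat split.
        - intros _ x [_ Hx]; rewrite Hin; unfold wave; [ring|].
          specialize (Hx ltac:(lia)); unfold vertex_position in Hx; simpl in Hx; lra.
        - injection H; lia.
        - injection H; lia. }
      destruct (classic (e = Channel N)) as [-> | H1].
      { exists (t, RtoC 0); cbn [fst snd]; repeat split.
        - intros _ x [Hx _]; rewrite Hout; unfold wave; [ring|].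
          specialize (Hx ltac:(lia)); lra.
        - intros H; now destruct (H0 H). }
      destruct (classic (edge_of N e)) as [He | He].
      - destruct (helmholtz_on_wave _ k (psi e) Hk (edge_interior_convex N h l e) (Hode e He))
          as (A & B & HAB).
        exists (A, B); cbn [fst snd]; repeat split; try contradiction.
        intros _; exact HAB.
      - exists (RtoC 0, RtoC 0); repeat split; contradiction. }
    (* A choice of amplitudes simultaneously on all edges. *)
    pose (AB := fun e => proj1_sig (constructive_indefinite_description _ (Hex e))).
    assert (HAB := fun e => proj2_sig (constructive_indefinite_description _ (Hex e))).
    fold (AB : edge -> C * C) in HAB.
    exists (fun e => fst (AB e)), (fun e => snd (AB e)); split; [|split; [|split]].
    + intros j Hj.
      apply (vertex_data_waves N h l k psi (fun e => fst (AB e)) (fun e => snd (AB e)) Hh Hl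
        (fun e => proj1 (HAB e)) j Hj), (Hv j Hj).
    + now apply (HAB (Channel 0)).
    + now apply (HAB (Channel N)).
    + now apply (HAB (Channel N)).
  - intros (A & B & Hsys & H0 & H1 & H2).
    exists (fun e => wave k (A e) (B e)), (B (Channel 0)); split; [|split; [|split]].
    + intros e _; now apply (helmholtz_wave _ k (A e) (B e)).
    + intros j Hj. apply (vertex_data_waves N h l k _ A B Hh Hl (fun e _ x _ => eq_refl) j Hj).
      apply (Hsys j Hj).
    + intros x _; unfold wave; rewrite H0; ring.
    + intros x _; unfold wave; rewrite H1, H2; ring.
Qed.

(** * Flux conservation and uniqueness of the transmission amplitude *)

Definition flux (y d : C) : R := Im (Cconj y * d).

Lemma flux_wave : forall (k : R) (A B : C) (x : R),
  flux (wave k A B x) (wave_slope k A B x) = k * (Cmod A ^ 2 - Cmod B ^ 2).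
Proof.
  intros k [a1 a2] [b1 b2] x; rewrite !Cmod2_alt.
  unfold flux, wave, wave_slope, expi; rewrite cos_neg, sin_neg; simpl.
  pose proof (sin2_cos2 (k * x)) as E; unfold Rsqr in E.
  transitivity (k * (a1 * a1 + a2 * a2 - b1 * b1 - b2 * b2) *
    (sin (k * x) * sin (k * x) + cos (k * x) * cos (k * x))); [ring|].
  rewrite E; ring.
Qed.

(** Both couplings are self-adjoint: one of the triples of values and derivatives
    is a multiple [z] of the real vector [theta], and the other is orthogonal to
    [theta], so the total flux is that of [z] against 0. *)
Lemma flux_coupling : forall c theta1 theta2 theta3 y1 y2 y3 d1 d2 d3,
  theta1 <> 0 -> theta2 <> 0 -> theta3 <> 0 ->
  coupling_condition c theta1 theta2 theta3 y1 y2 y3 d1 d2 d3 ->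
  flux y1 d1 + flux y2 d2 + flux y3 d3 = 0.
Proof.
  intros c theta1 theta2 theta3 y1 y2 y3 d1 d2 d3 N1 N2 N3.
  assert (Hmul : forall (s : R) (u z : C), s <> 0 -> (u / RtoC s)%C = z -> u = (RtoC s * z)%C).
  { intros s u z Hs <-; field; now apply RtoC_neq_0. }
  destruct c; intros (H12 & H23 & Hsum).
  - remember (y3 / RtoC theta3)%C as z eqn:Hz; symmetry in Hz.
    rewrite H23 in H12.
    apply Hmul in H12; apply Hmul in H23; apply Hmul in Hz; trivial; subst y1 y2 y3.
    transitivity (flux z (RtoC theta1 * d1 + RtoC theta2 * d2 + RtoC theta3 * d3)).
    + unfold flux; simpl; ring.
    + rewrite Hsum; unfold flux; simpl; ring.
  - remember (d3 / RtoC theta3)%C as z eqn:Hz; symmetry in Hz.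
    rewrite H23 in H12.
    apply Hmul in H12; apply Hmul in H23; apply Hmul in Hz; trivial; subst d1 d2 d3.
    transitivity (flux (RtoC theta1 * y1 + RtoC theta2 * y2 + RtoC theta3 * y3) z).
    + unfold flux; simpl; ring.
    + rewrite Hsum; unfold flux; simpl; ring.
Qed.

(** The flux on a resonator vanishes because it vanishes at the end [u_j]; hence
    the flux passes unchanged from one channel edge to the next. *)
Lemma amplitude_flux : forall (N : nat) (h l theta1 theta2 theta3 : R) c b (k : R) A B,
  theta1 <> 0 -> theta2 <> 0 -> theta3 <> 0 -> 0 < k ->
  amplitude_system N h l theta1 theta2 theta3 c b k A B ->
  forall j, (j <= N)%nat ->
    Cmod (A (Channel j)) ^ 2 - Cmod (B (Channel j)) ^ 2 =
    Cmod (A (Channel 0)) ^ 2 - Cmod (B (Channel 0)) ^ 2.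
Proof.
  intros N h l theta1 theta2 theta3 c b k A B N1 N2 N3 Hk Hsys.
  induction j as [|j IH]; intros Hj; [reflexivity|].
  rewrite <- IH by lia.
  destruct (Hsys (S j) ltac:(lia)) as [Hc Hb]; cbn [pred] in Hc; cbv zeta in Hc, Hb.
  apply flux_coupling in Hc; trivial.
  assert (Hres : flux (wave k (A (Resonator (S j))) (B (Resonator (S j))) 0)
    (wave_slope k (A (Resonator (S j))) (B (Resonator (S j))) 0) = 0).
  { rewrite flux_wave.
    rewrite <- (flux_wave k (A (Resonator (S j))) (B (Resonator (S j))) l).
    destruct b; rewrite Hb; unfold flux; simpl; ring. }
  rewrite Hres, flux_wave in Hc.
  assert (Hneg : forall y d, flux y (- d)%C = - flux y d)
    by (intros; unfold flux; simpl; ring).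
  rewrite Hneg, flux_wave in Hc.
  apply Rmult_eq_reg_l with k; lra.
Qed.

Lemma coupling_condition_minus :
  forall c theta1 theta2 theta3 y1 y2 y3 d1 d2 d3 y1' y2' y3' d1' d2' d3',
  coupling_condition c theta1 theta2 theta3 y1 y2 y3 d1 d2 d3 ->
  coupling_condition c theta1 theta2 theta3 y1' y2' y3' d1' d2' d3' ->
  coupling_condition c theta1 theta2 theta3
    (y1 - y1')%C (y2 - y2')%C (y3 - y3')%C (d1 - d1')%C (d2 - d2')%C (d3 - d3')%C.
Proof.
  intros c theta1 theta2 theta3 y1 y2 y3 d1 d2 d3 y1' y2' y3' d1' d2' d3'.
  assert (Ediv : forall u v w : C, ((u - v) / w = u / w - v / w)%C)
    by (intros; unfold Cdiv; ring).
  assert (Esum : forall a1 a2 a3 u1 u2 u3 v1 v2 v3 : C,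
    (a1 * u1 + a2 * u2 + a3 * u3 = RtoC 0)%C -> (a1 * v1 + a2 * v2 + a3 * v3 = RtoC 0)%C ->
    (a1 * (u1 - v1) + a2 * (u2 - v2) + a3 * (u3 - v3) = RtoC 0)%C).
  { intros a1 a2 a3 u1 u2 u3 v1 v2 v3 Hu Hv.
    transitivity ((a1 * u1 + a2 * u2 + a3 * u3) - (a1 * v1 + a2 * v2 + a3 * v3))%C;
      [ring | rewrite Hu, Hv; ring]. }
  destruct c; intros (P1 & P2 & P3) (Q1 & Q2 & Q3); simpl;
    rewrite !Ediv, P1, P2, Q1, Q2; auto.
Qed.

Lemma amplitude_system_minus :
  forall (N : nat) (h l theta1 theta2 theta3 : R) c b (k : R) A A' B B',
  amplitude_system N h l theta1 theta2 theta3 c b k A B ->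
  amplitude_system N h l theta1 theta2 theta3 c b k A' B' ->
  amplitude_system N h l theta1 theta2 theta3 c b k
    (fun e => A e - A' e)%C (fun e => B e - B' e)%C.
Proof.
  intros N h l theta1 theta2 theta3 c b k A A' B B' H H' j Hj.
  assert (Ew : forall e x, wave k (A e - A' e)%C (B e - B' e)%C x =
    (wave k (A e) (B e) x - wave k (A' e) (B' e) x)%C)
    by (intros; unfold wave; ring).
  assert (Es : forall e x, wave_slope k (A e - A' e)%C (B e - B' e)%C x =
    (wave_slope k (A e) (B e) x - wave_slope k (A' e) (B' e) x)%C)
    by (intros; unfold wave_slope; ring).
  assert (Eopp : forall u v : C, (- (u - v) = - u - - v)%C) by (intros; ring).
  destruct (H j Hj) as [Hc Hb], (H' j Hj) as [Hc' Hb']; cbv zeta in Hc, Hb, Hc', Hb'.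
  unfold amplitude_condition; cbv zeta; split.
  - rewrite !Ew, !Es, Eopp; now apply coupling_condition_minus.
  - destruct b; rewrite ?Es, ?Ew, Hb, Hb'; ring.
Qed.

(** The difference of two solutions has no incoming wave, so its flux is
    nonpositive on the incoming lead and nonnegative on the outgoing one. *)
Lemma transmission_unique :
  forall (N : nat) (h l theta1 theta2 theta3 : R) c b (k : R) A A' B B',
  theta1 <> 0 -> theta2 <> 0 -> theta3 <> 0 -> 0 < k ->
  amplitude_system N h l theta1 theta2 theta3 c b k A B ->
  amplitude_system N h l theta1 theta2 theta3 c b k A' B' ->
  A (Channel 0) = A' (Channel 0) -> B (Channel N) = B' (Channel N) ->
  A (Channel N) = A' (Channel N).
Proof.
  intros N h l theta1 theta2 theta3 c b k A A' B B' N1 N2 N3 Hk H H' E0 EN.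
  pose proof (amplitude_flux _ _ _ _ _ _ _ _ _ _ _ N1 N2 N3 Hk
    (amplitude_system_minus _ _ _ _ _ _ _ _ _ _ _ _ _ H H') N (le_n N)) as F.
  cbv beta in F; rewrite E0, EN in F.
  assert (Z : forall u : C, Cmod (u - u)%C = 0).
  { intros u; replace (u - u)%C with (RtoC 0) by ring; apply Cmod_0. }
  rewrite !Z in F.
  assert (Hz : Cmod (A (Channel N) - A' (Channel N))%C = 0).
  { pose proof (pow2_ge_0 (Cmod (B (Channel 0) - B' (Channel 0))%C)).
    pose proof (pow2_ge_0 (Cmod (A (Channel N) - A' (Channel N))%C)).
    apply Rsqr_0_uniq; unfold Rsqr; lra. }
  apply Cmod_eq_0 in Hz.
  transitivity (A (Channel N) - A' (Channel N) + A' (Channel N))%C;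
    [ring | rewrite Hz; ring].
Qed.

(** * The duality *)

Definition dual_coupling (c : coupling_type) : coupling_type :=
  match c with TypeI => TypeII | TypeII => TypeI end.

Definition dual_endpoint (b : endpoint_type) : endpoint_type :=
  match b with Neumann => Dirichlet | Dirichlet => Neumann end.

Definition parity_sign (j : nat) : C := RtoC ((-1) ^ j).

(** A resonator takes the sign of the channel edge to the right of its vertex:
    on both, the coordinate increases away from the vertex. *)
Definition edge_sign (e : edge) : C :=
  match e with Channel j => parity_sign j | Resonator j => parity_sign j end.

Lemma coupling_condition_dual :
  forall c theta1 theta2 theta3 y1 y2 y3 d1 d2 d3 alpha beta,
  coupling_condition c theta1 theta2 theta3 y1 y2 y3 d1 d2 d3 ->
  coupling_condition (dual_coupling c) theta1 theta2 theta3
    (alpha * d1)%C (alpha * d2)%C (alpha * d3)%C (beta * y1)%C (beta * y2)%C (beta * y3)%C.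
Proof.
  intros c theta1 theta2 theta3 y1 y2 y3 d1 d2 d3 alpha beta.
  assert (Ediv : forall u v w : C, (u * v / w = u * (v / w))%C)
    by (intros; unfold Cdiv; ring).
  assert (Esum : forall a a1 a2 a3 u1 u2 u3 : C,
    (a1 * u1 + a2 * u2 + a3 * u3 = RtoC 0)%C ->
    (a1 * (a * u1) + a2 * (a * u2) + a3 * (a * u3) = RtoC 0)%C).
  { intros a a1 a2 a3 u1 u2 u3 Hu.
    transitivity (a * (a1 * u1 + a2 * u2 + a3 * u3))%C; [ring | rewrite Hu; ring]. }
  destruct c; intros (P1 & P2 & P3); simpl; rewrite !Ediv, P1, P2; auto.
Qed.

(** The new amplitudes are those of [edge_sign e * psi' / (i k)]: differentiating
    a wave and dividing by [i k] fixes [A] and changes the sign of [B]. *)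
Lemma amplitude_system_dual :
  forall (N : nat) (h l theta1 theta2 theta3 : R) c b (k : R) A B,
  0 < k ->
  amplitude_system N h l theta1 theta2 theta3 c b k A B ->
  amplitude_system N h l theta1 theta2 theta3 (dual_coupling c) (dual_endpoint b) k
    (fun e => edge_sign e * A e)%C (fun e => - (edge_sign e * B e))%C.
Proof.
  intros N h l theta1 theta2 theta3 c b k A B Hk H j Hj.
  assert (NZ : (RtoC k * Ci)%C <> RtoC 0).
  { intros E; apply (f_equal snd) in E; simpl in E; lra. }
  assert (Ew : forall e x, wave k (edge_sign e * A e)%C (- (edge_sign e * B e))%C x =
    (edge_sign e * / (RtoC k * Ci) * wave_slope k (A e) (B e) x)%C).
  { intros e x; unfold wave, wave_slope.
    transitivity (edge_sign e * ((RtoC k * Ci) * / (RtoC k * Ci)) *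
      (A e * expi (k * x) - B e * expi (- (k * x))))%C; [|ring].
    rewrite Cinv_r by exact NZ; ring. }
  assert (Es : forall e x, wave_slope k (edge_sign e * A e)%C (- (edge_sign e * B e))%C x =
    (edge_sign e * (RtoC k * Ci) * wave k (A e) (B e) x)%C)
    by (intros; unfold wave, wave_slope; ring).
  destruct (H j Hj) as [Hc Hb]; cbv zeta in Hc, Hb.
  unfold amplitude_condition; cbv zeta; split.
  - apply coupling_condition_dual with (alpha := (parity_sign j * / (RtoC k * Ci))%C)
      (beta := (parity_sign j * (RtoC k * Ci))%C) in Hc.
    (* The reversed orientation of the left channel edge is absorbed by the
       change of sign across the vertex. *)
    assert (Esign : parity_sign (pred j) = (- parity_sign j)%C).
    { destruct j as [|i]; [lia|]; unfold parity_sign; cbn [pred pow].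
      rewrite <- RtoC_opp; f_equal; ring. }
    rewrite !Ew, !Es; cbn [edge_sign]; rewrite Esign.
    set (s := parity_sign j) in *; set (q := (RtoC k * Ci)%C) in *.
    match type of Hc with
    | coupling_condition _ _ _ _ (_ * - ?d)%C _ _ (_ * ?y)%C _ _ =>
        replace (- s * / q * d)%C with (s * / q * - d)%C by ring;
        replace (- (- s * q * y))%C with (s * q * y)%C by ring
    end.
    exact Hc.
  - destruct b; cbn [dual_endpoint]; rewrite ?Es, ?Ew, Hb; ring.
Qed.

Lemma scattering_dual :
  forall (N : nat) (h l theta1 theta2 theta3 : R) c b (k : R) (t : C),
  (1 <= N)%nat -> 0 < h -> 0 < l -> 0 < k ->
  (exists psi r, is_scattering_solution N h l theta1 theta2 theta3 c b k psi r t) ->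
  exists psi r, is_scattering_solution N h l theta1 theta2 theta3
    (dual_coupling c) (dual_endpoint b) k psi r (parity_sign N * t)%C.
Proof.
  intros N h l theta1 theta2 theta3 c b k t HN Hh Hl Hk H.
  apply scattering_amplitude_system in H; trivial.
  destruct H as (A & B & Hsys & H0 & H1 & H2).
  apply scattering_amplitude_system; trivial.
  exists (fun e => edge_sign e * A e)%C, (fun e => - (edge_sign e * B e))%C; split.
  - now apply amplitude_system_dual.
  - cbn [edge_sign]; rewrite H0, H1, H2; split; [|split]; try ring.
    unfold parity_sign; simpl; ring.
Qed.

(** The duality maps the possible transmission amplitudes of either problem into
    those of the other.  If there are some, each problem has exactly one, and the
    two differ by a sign; if there are none, both predicates given to [epsilon]
    are empty, hence equal. *)
Lemma transmission_probability_dual :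
  forall (N : nat) (h l theta1 theta2 theta3 : R) c b (k : R),
  (1 <= N)%nat -> 0 < h -> 0 < l -> 0 < k ->
  theta1 <> 0 -> theta2 <> 0 -> theta3 <> 0 ->
  transmission_probability N h l theta1 theta2 theta3 c b k =
  transmission_probability N h l theta1 theta2 theta3
    (dual_coupling c) (dual_endpoint b) k.
Proof.
  intros N h l theta1 theta2 theta3 c b k HN Hh Hl Hk N1 N2 N3.
  unfold transmission_probability, transmission_amplitude.
  set (P := fun t : C => exists psi r,
    is_scattering_solution N h l theta1 theta2 theta3 c b k psi r t).
  set (Q := fun t : C => exists psi r,
    is_scattering_solution N h l theta1 theta2 theta3
      (dual_coupling c) (dual_endpoint b) k psi r t).
  assert (PQ : forall t, P t -> Q (parity_sign N * t)%C)
    by (intros t; now apply scattering_dual).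
  assert (QP : forall t, Q t -> P (parity_sign N * t)%C).
  { intros t Ht.
    apply (scattering_dual _ _ _ _ _ _ (dual_coupling c) (dual_endpoint b)) in Ht; trivial.
    destruct c, b; exact Ht. }
  destruct (classic (exists t, P t)) as [[t Ht] | Hnone].
  - assert (Huniq : forall t t', Q t -> Q t' -> t = t').
    { intros u u' Hu Hu'.
      apply scattering_amplitude_system in Hu; trivial.
      apply scattering_amplitude_system in Hu'; trivial.
      destruct Hu as (A & B & Hsys & A0 & <- & BN), Hu' as (A' & B' & Hsys' & A0' & <- & BN').
      apply (transmission_unique N h l theta1 theta2 theta3 (dual_coupling c)
        (dual_endpoint b) k A A' B B'); trivial; congruence. }
    assert (HP : P (epsilon (inhabits (RtoC 0)) P)) by (apply epsilon_spec; now exists t).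
    assert (HQ : Q (epsilon (inhabits (RtoC 0)) Q))
      by (apply epsilon_spec; exists (parity_sign N * t)%C; now apply PQ).
    rewrite (Huniq _ _ HQ (PQ _ HP)), Cmod_mult.
    unfold parity_sign; rewrite Cmod_R, pow_1_abs; ring.
  - replace Q with P; [reflexivity|].
    apply functional_extensionality; intros t; apply propositional_extensionality; split.
    + intros Ht; destruct Hnone; now exists t.
    + intros Ht; destruct Hnone; now exists (parity_sign N * t)%C; apply QP.
Qed.

Theorem mainTheorem7 :
  forall (N : nat) (h l theta1 theta2 theta3 : R),
    (1 <= N)%nat -> 0 < h -> 0 < l -> theta1 * theta2 * theta3 <> 0 ->
    forall k : R, 0 < k ->
      transmission_probability N h l theta1 theta2 theta3 TypeI Neumann k =
      transmission_probability N h l theta1 theta2 theta3 TypeII Dirichlet k /\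
      transmission_probability N h l theta1 theta2 theta3 TypeI Dirichlet k =
      transmission_probability N h l theta1 theta2 theta3 TypeII Neumann k.
Proof.
  intros N h l theta1 theta2 theta3 HN Hh Hl Htheta k Hk.
  assert (theta1 <> 0 /\ theta2 <> 0 /\ theta3 <> 0) as (N1 & N2 & N3).
  { repeat split; intros E; apply Htheta; rewrite E; ring. }
  split.
  - now apply (transmission_probability_dual N h l theta1 theta2 theta3 TypeI Neumann).
  - now apply (transmission_probability_dual N h l theta1 theta2 theta3 TypeI Dirichlet).
Qed.
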